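(* There exist $\varepsilon>0$, a confidence level $1-\kappa\in(0,1)$, and a family of optimization instances $\{\mathbf P_\lambda\}_{\lambda>0}$, $\min_{\mathbf x\in\mathcal X}F(\mathbf x;\lambda)=f(\mathbf x)+\gamma(\lambda)p(\mathbf x)$, with gradient estimators, satisfying the following assumptions defined in the context: LDP of target risk, unbiased gradient estimators with the relaxed absolute variance bound, smoothness and convexity of the average-case loss, sublevel-boundedness, zero minimum of the average-case loss, relative gradient and Hessian bounds, convexity of the combined objective; such that, for every family of (projected) SGD schemes $\{\mathcal A(\lambda)\}_{\lambda>0}$ chosen from $\mathbb A_{0,\mathrm{last}}$ (constant step size, last-iterate output), there exists a family of initializations $\{\mathbf x_0(\lambda)\}_{\lambda>0}\subset\mathcal X$ satisfying both the safe-start and the sub-exponential initial distance assumptions for which $$\limsup_{\lambda\to\infty}\frac1\lambda\log T^{\varepsilon,\kappa}_\lambda\big(\mathcal A(\lambda),\mathbf x_0(\lambda)\big)>0 .$$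
   Context: Setting. $\mathcal X\subseteq\mathbb R^n$ is the feasible set, $f:\mathcal X\to\mathbb R$ the average-case loss, $p:\mathcal X\to[0,\infty)$ the extreme risk, $\gamma(\lambda)>0$ a weight for each rarity level $\lambda>0$ ($f,p,\mathcal X$ do not depend on $\lambda$). $F(\mathbf x;\lambda)=f(\mathbf x)+\gamma(\lambda)p(\mathbf x)$; $\mathbf x^*(\lambda)$ is a minimizer of $F(\cdot;\lambda)$ over $\mathcal X$; $p^*(\lambda)=p(\mathbf x^*(\lambda))$. Convention: $\log 0=-\infty$. $\|\cdot\|$ is the Euclidean (or spectral) norm. Assumptions. (i) LDP of target risk: there is $I>0$ with $\lim_{\lambda\to\infty}\frac1\lambda\log p^*(\lambda)=-I$ and $\limsup_{\lambda\to\infty}\frac1\lambda\log\gamma(\lambda)=I$. (ii) Unbiased gradient estimators with relaxed absolute variance bound: for each $\lambda>0$ there are unbiased estimators $G_f(\mathbf x,\xi)$, $G_p(\mathbf x,\xi;\lambda)$ of $\nabla f(\mathbf x)$, $\nabla p(\mathbf x)$ ($\xi$ random), and constants $\sigma_f\ge0$, $C>0$ (independent of $\mathbf x$ and $\lambda$) such that for all $\mathbf x\in\mathcal X$: $\mathbb E\|G_f(\mathbf x,\xi)-\nabla f(\mathbf x)\|^2\le\sigma_f^2$ and $\mathbb E\|G_p(\mathbf x,\xi;\lambda)-\nabla p(\mathbf x)\|^2\le C\|\nabla p(\mathbf x)\|$. (iii) Safe start: with $I$ from (i), $\limsup_{\lambda\to\infty}\frac1\lambda\log p(\mathbf x_0(\lambda))\le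 -I$. (iv) Smoothness and convexity of the average-case loss: $\mathcal X$ is convex, closed, nonempty; $f$ is twice continuously differentiable, convex, and $\|\nabla^2f(\mathbf x)\|\le L_f$ on $\mathcal X$ for some $L_f>0$. (v) Sublevel-boundedness: there are $\epsilon_f,d_f>0$ such that $\{\mathbf x\in\mathcal X: f(\mathbf x)\le\epsilon_f\}$ is nonempty with diameter at most $d_f$. (Hence $f$ has a minimizer $\tilde{\mathbf x}^*$ over $\mathcal X$, which is fixed.) (vi) Zero minimum of the average-case loss: $f(\tilde{\mathbf x}^* )=0$. (vii) Relative gradient and Hessian bounds: $p:\mathcal X\to[0,\infty)$ is twice continuously differentiable and there are $L_{p,1},L_{p,2}>0$, $\beta_1,\beta_2\ge0$ with $\|\nabla p(\mathbf x)\|\le L_{p,1}(1+\|\mathbf x-\tilde{\mathbf x}^*\|^{\beta_1})p(\mathbf x)$ and $\|\nabla^2p(\mathbf x)\|\le L_{p,2}(1+\|\mathbf x-\tilde{\mathbf x}^*\|^{\beta_2})p(\mathbf x)$ for all $\mathbf x\in\mathcal X$. (viii) Convexity of the combined objective: $F(\cdot;\lambda)$ is convex on $\mathcal X$ for every $\lambda>0$. (ix) Sub-exponential initial distance: $\limsup_{\lambda\to\infty}\frac1\lambda\log\|\mathbf x_0(\lambda)-\tilde{\mathbf x}^*\|\le0$. SGD. A scheme in $\mathbb A_{0,\mathrm{last}}$ consists of a constant step size $\eta>0$ and a constant mini-batch size $B\ge1$; from $\mathbf x_0$ it iterates $\mathbf x_{t+1}=\Pi_{\mathcal X}(\mathbf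 x_t-\eta\bar G_t)$, $\bar G_t=\frac1B\sum_{i=1}^B\big(G_f(\mathbf x_t,\xi_{t,i})+\gamma(\lambda)G_p(\mathbf x_t,\xi_{t,i};\lambda)\big)$, with $\xi_{t,i}$ i.i.d. and $\Pi_{\mathcal X}$ the Euclidean projection, and after $T$ iterations it outputs $\mathbf x_T$. Sampling complexity. $T^{\varepsilon,\kappa}_\lambda(\mathcal A,\mathbf x_0)$ is the minimum number $T\cdot B$ of stochastic gradient samples such that the output $\hat{\mathbf x}$ after $T$ iterations started at $\mathbf x_0$ satisfies $F(\hat{\mathbf x};\lambda)\le(1+\varepsilon)F(\mathbf x^*(\lambda);\lambda)$ with probability at least $1-\kappa$ ($+\infty$ if there is none). *)

(* Defs.v *)
From HB Require Import structures.
From mathcomp Require Import all_boot all_order all_algebra.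
From mathcomp Require Import all_classical all_reals all_analysis.

Set Implicit Arguments.
Unset Strict Implicit.
Unset Printing Implicit Defensive.

Import Order.TTheory GRing.Theory Num.Theory.
Import numFieldNormedType.Exports.

Local Open Scope classical_set_scope.
Local Open Scope ring_scope.

(* The library norm on ['rV[R]_n] is the sup norm; it induces the same topology
   (hence the same notions of closed set, continuity and differentiability) as
   the Euclidean norm, but all quantitative bounds below are Euclidean. *)
Definition enorm (R : realType) (n : nat) (v : 'rV[R]_n) : R :=
  Num.sqrt (\sum_(i < n) v ord0 i ^+ 2).

(* The Euclidean operator norm of [A], acting on row vectors. *)
Definition spectral_norm (R : realType) (n : nat) (A : 'M[R]_n) : R :=
  sup [set enorm (v *m A) | v in [set v : 'rV[R]_n | enorm v <= 1]].

Definition gradient (R : realType) (n : nat) (f : 'rV[R]_n -> R)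
    (x : 'rV[R]_n) : 'rV[R]_n :=
  \row_(i < n) 'D_(delta_mx ord0 i) f x.

Definition hessian (R : realType) (n : nat) (f : 'rV[R]_n -> R)
    (x : 'rV[R]_n) : 'M[R]_n :=
  'J (gradient f) x.

(* Since [X] is merely closed, [f] is required to be C^2 on some open
   neighbourhood of [X]; its values off that neighbourhood are irrelevant. *)
Definition C2_on (R : realType) (n : nat) (X : set 'rV[R]_n)
    (f : 'rV[R]_n -> R) : Prop :=
  exists U : set 'rV[R]_n, [/\ open U, X `<=` U &
    forall x, U x -> [/\ differentiable f x, differentiable (gradient f) x &
      {for x, continuous (hessian f)}]].

Definition is_minimizer (R : realType) (n : nat) (X : set 'rV[R]_n)
    (f : 'rV[R]_n -> R) (x : 'rV[R]_n) : Prop :=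
  X x /\ forall y, X y -> f x <= f y.

(* The minimizer exists and is unique when [X] is closed, convex, nonempty. *)
Definition euclid_proj (R : realType) (n : nat) (X : set 'rV[R]_n)
    (y : 'rV[R]_n) : 'rV[R]_n :=
  get (is_minimizer X (fun x => enorm (x - y))).

(* [lne] is the extended logarithm, with [lne 0 = -oo] and [lne +oo = +oo]. *)
Definition log_rate (R : realType) (h : R -> \bar R) : R -> \bar R :=
  fun l => ((l^-1)%:E * lne (h l))%E.

Definition limsup_log_rate (R : realType) (h : R -> \bar R) : \bar R :=
  limf_esup (log_rate h) (pinfty_nbhs R).

(* Functions of the rarity level [l] are total on [R]; only their values at
   [0 < l] are ever constrained. *)
Record problem (R : realType) (n : nat) := Problem {
  feas : set 'rV[R]_n ;
  avg_loss : 'rV[R]_n -> R ;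
  risk : 'rV[R]_n -> R ;
  weight : R -> R ;
  xtilde : 'rV[R]_n ;
  xstar : R -> 'rV[R]_n }.

Definition objective (R : realType) (n : nat) (pb : problem R n) (l : R)
    (x : 'rV[R]_n) : R :=
  avg_loss pb x + weight pb l * risk pb x.

Definition well_posed (R : realType) (n : nat) (pb : problem R n) : Prop :=
  [/\ forall x, feas pb x -> 0 <= risk pb x,
      forall l, 0 < l -> 0 < weight pb l,
      is_minimizer (feas pb) (avg_loss pb) (xtilde pb) &
      forall l, 0 < l -> is_minimizer (feas pb) (objective pb l) (xstar pb l)].

(* A stochastic gradient oracle: the law of the random seed, the estimators of
   the two gradients ([est_risk l x z] estimates the gradient of the risk at
   rarity level [l]), and seeds [seed t i] for iteration [t] and mini-batch
   position [i]. *)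
Record oracle (R : realType) (n : nat) := Oracle {
  seed_disp : measure_display ;
  seed_type : measurableType seed_disp ;
  seed_law : probability seed_type R ;
  est_avg : 'rV[R]_n -> seed_type -> 'rV[R]_n ;
  est_risk : R -> 'rV[R]_n -> seed_type -> 'rV[R]_n ;
  sample_disp : measure_display ;
  sample_space : measurableType sample_disp ;
  prob : probability sample_space R ;
  seed : nat -> nat -> {RV prob >-> seed_type} }.

Arguments est_avg {R n} o x z.
Arguments est_risk {R n} o l x z.

Definition mutually_independent (R : realType) (d d' : measure_display)
    (Om : measurableType d) (T : measurableType d') (P : probability Om R)
    (K : eqType) (X : K -> {RV P >-> T}) : Prop :=
  forall (s : seq K) (A : K -> set T), uniq s ->
    (forall k, measurable (A k)) ->
    P (\bigcap_(k in [set` s]) (X k @^-1` A k)) =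
    (\prod_(k <- s) P (X k @^-1` A k))%E.

Definition iid_seeds (R : realType) (n : nat) (orc : oracle R n) : Prop :=
  (forall t i A, measurable A ->
     distribution (prob orc) (seed orc t i) A = seed_law orc A) /\
  mutually_independent (fun k : nat * nat => seed orc k.1 k.2).

(* Joint measurability in the point and the seed, with the Borel sigma-algebra
   on the space of points, makes the SGD iterates random variables. *)
Definition jointly_measurable (R : realType) (n : nat) (d : measure_display)
    (T : measurableType d) (X : set 'rV[R]_n)
    (G : 'rV[R]_n -> T -> 'rV[R]_n) : Prop :=
  forall i : 'I_n, measurable_fun
    ([set z | X z.1] : set (g_sigma_algebraType (@open 'rV[R]_n) * T)%type)
    (fun z => G z.1 z.2 ord0 i).

Definition unbiased_at (R : realType) (n : nat) (d : measure_display)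
    (T : measurableType d) (Q : probability T R) (G : T -> 'rV[R]_n)
    (g : 'rV[R]_n) : Prop :=
  forall i : 'I_n,
    Q.-integrable setT (EFin \o (fun z => G z ord0 i)) /\
    ('E_Q[fun z => G z ord0 i] = (g ord0 i)%:E)%E.

Definition mean_square_error (R : realType) (n : nat) (d : measure_display)
    (T : measurableType d) (Q : probability T R) (G : T -> 'rV[R]_n)
    (g : 'rV[R]_n) : \bar R :=
  ('E_Q[fun z => (enorm (G z - g) ^+ 2)%R])%E.

Definition ldp_target_risk (R : realType) (n : nat) (pb : problem R n)
    (I : R) : Prop :=
  [/\ 0 < I,
      log_rate (fun l => (risk pb (xstar pb l))%:E) @ pinfty_nbhs R
        --> (- I)%:E &
      limsup_log_rate (fun l => (weight pb l)%:E) = I%:E].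

Definition relaxed_variance_estimators (R : realType) (n : nat)
    (pb : problem R n) (orc : oracle R n) : Prop :=
  [/\ jointly_measurable (feas pb) (est_avg orc),
      forall l, 0 < l -> jointly_measurable (feas pb) (est_risk orc l) &
      exists sigma C : R, [/\ 0 <= sigma, 0 < C &
        forall l, 0 < l -> forall x, feas pb x ->
        [/\ unbiased_at (seed_law orc) (est_avg orc x)
              (gradient (avg_loss pb) x),
            unbiased_at (seed_law orc) (est_risk orc l x)
              (gradient (risk pb) x),
            (mean_square_error (seed_law orc) (est_avg orc x)
              (gradient (avg_loss pb) x) <= (sigma ^+ 2)%:E)%E &
            (mean_square_error (seed_law orc) (est_risk orc l x)
              (gradient (risk pb) x)
              <= (C * enorm (gradient (risk pb) x))%:E)%E]]].

Definition safe_start (R : realType) (n : nat) (pb : problem R n) (I : R)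
    (x0 : R -> 'rV[R]_n) : Prop :=
  (limsup_log_rate (fun l => (risk pb (x0 l))%:E) <= (- I)%:E)%E.

Definition smooth_convex_loss (R : realType) (n : nat)
    (pb : problem R n) : Prop :=
  [/\ feas pb !=set0, closed (feas pb), convex_set (feas pb),
      C2_on (feas pb) (avg_loss pb) &
      convex_function (feas pb) (avg_loss pb)] /\
  exists Lf : R, 0 < Lf /\
    forall x, feas pb x -> spectral_norm (hessian (avg_loss pb) x) <= Lf.

Definition sublevel_bounded (R : realType) (n : nat)
    (pb : problem R n) : Prop :=
  exists ef df : R, [/\ 0 < ef, 0 < df,
    exists x, feas pb x /\ avg_loss pb x <= ef &
    forall x y, feas pb x -> avg_loss pb x <= ef ->
      feas pb y -> avg_loss pb y <= ef -> enorm (x - y) <= df].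

Definition zero_min_loss (R : realType) (n : nat) (pb : problem R n) : Prop :=
  avg_loss pb (xtilde pb) = 0.

Definition relative_bounds (R : realType) (n : nat)
    (pb : problem R n) : Prop :=
  C2_on (feas pb) (risk pb) /\
  exists L1 L2 b1 b2 : R, [/\ 0 < L1, 0 < L2, 0 <= b1, 0 <= b2 &
    forall x, feas pb x ->
      enorm (gradient (risk pb) x)
        <= L1 * (1 + enorm (x - xtilde pb) `^ b1) * risk pb x /\
      spectral_norm (hessian (risk pb) x)
        <= L2 * (1 + enorm (x - xtilde pb) `^ b2) * risk pb x].

Definition convex_objective (R : realType) (n : nat)
    (pb : problem R n) : Prop :=
  forall l : R, 0 < l -> convex_function (feas pb) (objective pb l).

Definition subexp_initial_distance (R : realType) (n : nat)
    (pb : problem R n) (x0 : R -> 'rV[R]_n) : Prop :=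
  (limsup_log_rate (fun l => (enorm (x0 l - xtilde pb))%:E) <= 0)%E.

(* A projected SGD scheme with constant step and batch sizes, returning its
   last iterate. *)
Record scheme (R : realType) := Scheme {
  step : R ;
  batch : nat ;
  step_gt0 : 0 < step ;
  batch_gt0 : (0 < batch)%N }.

Definition minibatch (R : realType) (n : nat) (pb : problem R n)
    (orc : oracle R n) (l : R) (B t : nat) (x : 'rV[R]_n)
    (w : sample_space orc) : 'rV[R]_n :=
  B%:R^-1 *: \sum_(i < B) (est_avg orc x (seed orc t i w)
    + weight pb l *: est_risk orc l x (seed orc t i w)).

Arguments minibatch {R n} pb orc l B t x w.

Fixpoint iterate (R : realType) (n : nat) (pb : problem R n)
    (orc : oracle R n) (l : R) (a : scheme R) (x0 : 'rV[R]_n) (t : nat)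
    (w : sample_space orc) : 'rV[R]_n :=
  if t is t'.+1 then
    let x := iterate pb l a x0 t' w in
    euclid_proj (feas pb) (x - step a *: minibatch pb orc l (batch a) t' x w)
  else x0.

Arguments iterate {R n} pb orc l a x0 t w.

(* The infimum is over extended reals, so it is [+oo] when no [T] succeeds. *)
Definition sampling_complexity (R : realType) (n : nat) (pb : problem R n)
    (orc : oracle R n) (eps kappa l : R) (a : scheme R)
    (x0 : 'rV[R]_n) : \bar R :=
  ereal_inf [set ((T * batch a)%N%:R)%:E | T in [set T : nat |
    ((1 - kappa)%:E <= prob orc [set w |
       (objective pb l (iterate pb orc l a x0 T w)
         <= (1 + eps) * objective pb l (xstar pb l))%R])%E]].

(* Main.v *)
(* The instance is one-dimensional: f(x) = x and p(x) = exp(-x) on [0, oo), with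
   weight exp(l), so that x*(l) = l and the optimal value is l + 1.  The loss has
   an exact oracle; the estimator of p' is off by a fair sign times exp(-3l/4),
   but only for l/2 <= x <= 3l/2.  There the step gets a random push of order
   step * exp(l/4) / batch.

   Put K = exp(l/16) and assume that T * batch < K.  If the step is at most 1/K,
   start at 2l: as long as x > 3l/2 an iteration moves left by at most the step,
   so 3l/2 is not reached.  If the step exceeds 1/K, start at 3l/2: unless the
   signs of the first batch cancel exactly, which has probability at most 1/2, the
   noise dominates.  A positive sum projects the iterate to 0, whence the gradient
   1 - exp(l) of the next iteration throws it to the far right; a negative sum
   throws it there at once.  Coming back at one step per iteration takes more than
   K iterations.  So below K samples the success probability is at most 1/2.

   The independent fair coins are binary digits of a uniform point of [0, 1]. *)
Require Import Defs.
From HB Require Import structures.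
From mathcomp Require Import all_boot all_order all_algebra.
From mathcomp Require Import all_classical all_reals all_analysis.
From mathcomp Require Import measurable_realfun zify ring lra.

Set Implicit Arguments.
Unset Strict Implicit.
Unset Printing Implicit Defensive.

Import Order.TTheory GRing.Theory Num.Theory.
Import numFieldNormedType.Exports.

Local Open Scope classical_set_scope.
Local Open Scope ring_scope.

(** * Independent fair coins from binary digits *)

Definition uniform01 (R : realType) : probability (measurableTypeR R) R :=
  uniform_prob (ltr01 : 0 < 1 :> R).

Definition fair_coin (R : realType) : probability bool R :=
  bernoulli_prob (2^-1 : R).

(** The binary digit of weight 2^-(k+1) when [w] lies in [0, 1); a negative [w] truncates to 0 and
    gets the digit 0. *)
Definition digit (R : realType) (k : nat) (w : R) : bool :=
  odd (Num.truncn (2 ^+ k.+1 * w)).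

Definition dyadic (R : realType) (m j : nat) : set R :=
  `[j%:R / 2 ^+ m, j.+1%:R / 2 ^+ m[.

Arguments dyadic : clear implicits.

Section Digits.
Variable R : realType.
Implicit Types (w : R) (A : nat -> set bool).
Local Notation P := (@uniform01 R).

Lemma dyadicE m j w :
  dyadic R m j w <-> j%:R <= 2 ^+ m * w < j.+1%:R.
Proof.
have p0 : 0 < 2 ^+ m :> R by rewrite exprn_gt0.
by rewrite /dyadic /= in_itv /= ler_pdivrMr // ltr_pdivlMr // [w * _]mulrC.
Qed.

Lemma measurable_dyadic m j : measurable (dyadic R m j).
Proof. exact: measurable_itv. Qed.

Lemma dyadic_split m j :
  dyadic R m j = dyadic R m.+1 j.*2 `|` dyadic R m.+1 j.*2.+1.
Proof.
have e1 : j.*2%:R = 2 * j%:R :> R by rewrite -muln2 natrM mulrC.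
have e2 k : k.+1%:R = k%:R + 1 :> R by rewrite natr1.
apply/seteqP; split => w.
  move=> /dyadicE; rewrite e2 => /andP[h1 h2].
  case: (ltP (2 * (2 ^+ m * w)) (2 * j%:R + 1)) => h; [left|right];
    apply/dyadicE; rewrite exprS -mulrA
    ?[j.*2.+1%:R]e2 ?[j.*2.+2%:R]e2 ?[j.*2.+1%:R]e2 e1; lra.
by case => /dyadicE; rewrite exprS -mulrA
  ?[j.*2.+1%:R]e2 ?[j.*2.+2%:R]e2 ?[j.*2.+1%:R]e2 e1 => ?; apply/dyadicE;
  rewrite e2; lra.
Qed.

Lemma dyadic_disjoint m j :
  dyadic R m j.*2 `&` dyadic R m j.*2.+1 = set0.
Proof.
apply/seteqP; split => // w [] /dyadicE /andP[_ h1] /dyadicE /andP[h2 _].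
by move: (lt_le_trans h1 h2); rewrite ltxx.
Qed.

Lemma digit_dyadic m j w : dyadic R m.+1 j w -> digit m w = odd j.
Proof. by move=> /dyadicE h; rewrite /digit (truncn_def h). Qed.

Lemma measurable_digit k : measurable_fun setT (@digit R k).
Proof.
apply: (measurable_fun_bool true); rewrite setTI.
have -> : @digit R k @^-1` [set true] =
    \bigcup_(j in [set j | odd j]) dyadic R k.+1 j.
  apply/seteqP; split => w /=.
    move=> h; exists (Num.truncn (2 ^+ k.+1 * w)) => //.
    apply/dyadicE; apply: truncn_itv; rewrite leNgt; apply/negP => w0.
    by move: h; rewrite /digit truncn_floor leNgt w0.
  by case=> j oj /digit_dyadic ->.
by apply: bigcup_measurable => j _; exact: measurable_dyadic.
Qed.

Lemma uniform01_dyadic m j : (j < 2 ^ m)%N ->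
  P (dyadic R m j) = (2 ^- m)%:E.
Proof.
move=> jm; rewrite /uniform01 /= /uniform_prob.
have p0 : 0 < 2 ^+ m :> R by rewrite exprn_gt0.
rewrite (eq_integral (fun=> 1%:E)); last first.
  move=> w; rewrite inE => /dyadicE /andP[h1 h2]; rewrite /uniform_pdf ifT.
    by rewrite subr0 invr1.
  have h3 : j.+1%:R <= 2 ^+ m :> R by rewrite -natrX ler_nat.
  have j0 : 0 <= j%:R :> R by [].
  rewrite -(ler_pM2l p0) -[w <= 1](ler_pM2l p0); lra.
rewrite integral_cst /=; last exact: measurable_dyadic.
rewrite mul1e lebesgue_measure_itv /= lte_fin ltr_pM2r ?invr_gt0 // ltr_nat.
by rewrite ltnSn -EFinB -mulrBl -natrB // subSnn mul1r.
Qed.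

Lemma fair_coinE (B : set bool) :
  fair_coin R B = ((true \in B)%:R / 2 + (false \in B)%:R / 2)%:E.
Proof.
rewrite /fair_coin /= bernoulli_probE; last lra.
rewrite !diracE -!EFinM -EFinD; congr EFin.
by rewrite /unstable.onem [X in X * (false \in B)%:R](_ : _ = 2^-1); last field; ring.
Qed.

Definition cylinder A m d : set R :=
  [set w | forall k, (m <= k < m + d)%N -> A k (digit k w)].

Lemma measurable_cylinder A m d : measurable (cylinder A m d).
Proof.
have -> : cylinder A m d =
    \bigcap_(k in [set k | (m <= k < m + d)%N]) (@digit R k @^-1` A k).
  by apply/seteqP; split => w h k; apply: h.
apply: bigcap_measurableType => k _; rewrite -[X in measurable X]setTI.
exact: measurable_digit.
Qed.

(** Induction on [d]. Cutting a dyadic interval of level [m] in half fixes digit [m]; a half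
    survives only if its parity lies in [A m], and it carries half the measure, so the two halves
    together yield the factor of [A m]. *)
Lemma dyadic_cylinder A m d j : (j < 2 ^ m)%N ->
  P (dyadic R m j `&` cylinder A m d) =
  ((2 ^- m)%:E * \prod_(m <= k < m + d) fair_coin R (A k))%E.
Proof.
elim: d m j => [|d IH] m j jm.
  rewrite addn0 big_geq // mule1 (_ : cylinder A m 0 = setT).
    by rewrite setIT uniform01_dyadic.
  by apply/seteqP; split => // w _ k /=; rewrite addn0; lia.
have cyl (b : bool) : dyadic R m.+1 (b + j.*2) `&` cylinder A m d.+1 =
    if b \in A m then dyadic R m.+1 (b + j.*2) `&` cylinder A m.+1 d else set0.
  apply/seteqP; split => [w [wj wA]|w].
    have := wA m; rewrite (digit_dyadic wj) oddD odd_double addbF oddb.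
    rewrite leqnn addnS ltnS leq_addr.
    move=> /(_ isT) bA; rewrite mem_set //; split => // k kk; apply: wA; lia.
  case: ifPn => // /set_mem bA [wj wA]; split => // k kk.
  have [->|km] := eqVneq k m; last by apply: wA; lia.
  by rewrite (digit_dyadic wj) oddD odd_double addbF oddb.
have lt2 (b : bool) : (b + j.*2 < 2 ^ m.+1)%N by rewrite expnS; case: b; lia.
have Pcyl (b : bool) : P (dyadic R m.+1 (b + j.*2) `&` cylinder A m d.+1) =
    (((b \in A m)%:R / 2 * 2 ^- m)%:E *
      \prod_(m.+1 <= k < m + d.+1) fair_coin R (A k))%E.
  rewrite cyl; case: (b \in A m); last by rewrite measure0 !mul0r mul0e.
  by rewrite IH ?lt2 // addSnnS mul1r exprS invfM.
rewrite dyadic_split setIUl measureU; last first.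
- by rewrite setIACA (dyadic_disjoint m.+1) set0I.
- apply: measurableI; [exact: measurable_dyadic|exact: measurable_cylinder].
- apply: measurableI; [exact: measurable_dyadic|exact: measurable_cylinder].
transitivity (P (dyadic R m.+1 (false + j.*2) `&` cylinder A m d.+1) +
    P (dyadic R m.+1 (true + j.*2) `&` cylinder A m d.+1))%E; first by [].
rewrite !Pcyl.
rewrite -ge0_muleDl; last 2 first.
- by rewrite lee_fin mulr_ge0 // ?mulr_ge0 // invr_ge0 exprn_ge0.
- by rewrite lee_fin mulr_ge0 // ?mulr_ge0 // invr_ge0 exprn_ge0.
rewrite -EFinD -mulrDl [in RHS]big_ltn; last lia.
by rewrite fair_coinE muleA -EFinM; congr (_%:E * _)%E; ring.
Qed.

Lemma uniform01_cylinder A d :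
  P (cylinder A 0 d) = (\prod_(0 <= k < d) fair_coin R (A k))%E.
Proof.
have D1 : P (dyadic R 0 0) = 1%E by rewrite uniform01_dyadic // expr0 invr1.
have mD := measurable_dyadic 0 0; have mC := measurable_cylinder A 0 d.
(* The summand 0 stands for the part of the cylinder outside [0, 1), a null set. *)
transitivity (0 + P (dyadic R 0 0 `&` cylinder A 0 d))%E; last first.
  by rewrite dyadic_cylinder // expr0 invr1 mul1e add0e.
rewrite [LHS](measureDI P mC mD) setIC; congr (_ + _)%E.
apply: (@subset_measure0 _ _ _ P _ (~` dyadic R 0 0)).
- exact: measurableD.
- exact: measurableC.
- by move=> w [].
- by rewrite [LHS](probability_setC P mD) D1 subee.
Qed.

(** Ranks absent from [s] are given the full set, whose factor is 1; the event becomes a cylinder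
    over an initial segment of digits. *)
Lemma digits_independent (s : seq nat) A : uniq s ->
  P (\bigcap_(k in [set` s]) (@digit R k @^-1` A k)) =
  (\prod_(k <- s) fair_coin R (A k))%E.
Proof.
move=> us; pose A' k := if k \in s then A k else setT.
have [d sd] : exists d, forall k, k \in s -> (k < d)%N.
  exists (\max_(k <- s) k).+1 => k ks; rewrite ltnS.
  by rewrite (big_rem k) //= leq_maxl.
have -> : \bigcap_(k in [set` s]) (@digit R k @^-1` A k) = cylinder A' 0 d.
  apply/seteqP; split => w h k /=.
    by rewrite /A'; case: ifPn => // ks _; exact: h.
  by move=> ks; have := h k; rewrite /A' ks; apply; rewrite sd.
rewrite uniform01_cylinder (bigID (mem s)) /= [X in (_ * X)%E]big1 ?mule1; last first.
  by move=> k /negbTE ks; rewrite /A' ks probability_setT.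
rewrite -big_filter; under eq_big_seq => k.
  by rewrite mem_filter => /andP[ks _]; rewrite /A' ks; over.
apply: perm_big; apply: uniq_perm => //; first exact/filter_uniq/iota_uniq.
move=> k; rewrite mem_filter mem_index_iota /=.
by case: (boolP (k \in s)) => //= /sd ->.
Qed.

Lemma digit_distribution k (A : set bool) : P (@digit R k @^-1` A) = fair_coin R A.
Proof.
have := @digits_independent [:: k] (fun=> A) isT.
rewrite big_seq1 => <-; congr (P _); apply/seteqP; split=> w h.
  by move=> i /=; rewrite inE => /eqP ->.
by apply: (h k); rewrite /= inE.
Qed.

(* [pickle] turns the pair (iteration, batch position) into the rank of a digit. *)
Definition digit_seed (t i : nat) : {RV P >-> bool} :=
  HB.pack (@digit R (pickle (t, i)))
    (isMeasurableFun.Build _ _ (measurableTypeR R) bool _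
      (measurable_digit (pickle (t, i)))).

Lemma digit_seeds_independent :
  mutually_independent (fun k : nat * nat => digit_seed k.1 k.2).
Proof.
move=> s A us mA.
(* Only codes of pairs are fed to [A'], so the default (0, 0) never enters. *)
pose A' k := A (odflt (0%N, 0%N) (unpickle k)).
have A'E k : A' (pickle k) = A k by rewrite /A' pickleK.
have := @digits_independent (map pickle s) A'.
rewrite map_inj_uniq; last exact: (pcan_inj pickleK).
move=> /(_ us); rewrite big_map => PA'.
rewrite [RHS](eq_bigr (fun k => fair_coin R (A' (pickle k)))); last first.
  by move=> [t i] _; rewrite A'E -(digit_distribution (pickle (t, i))).
rewrite -PA'; congr (P _); apply/seteqP; split => w h.
  by move=> _ /= /mapP[[t i] ks ->]; rewrite A'E; exact: (h (t, i)).
move=> [t i] ks; have /= := h (pickle (t, i)); rewrite A'E; apply.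
by rewrite map_f.
Qed.

Lemma uniform01_seed_vector (t B : nat) (v : {ffun 'I_B -> bool}) :
  P [set w | forall i : 'I_B, digit_seed t i w = v i] = (2 ^- B)%:E.
Proof.
(* [A] has to be total on pairs of numbers; positions outside the batch are left unconstrained. *)
pose A (k : nat * nat) : set bool :=
  [set b | if insub k.2 is Some i then b = v i else True].
have := @digit_seeds_independent [seq (t, val i) | i <- enum 'I_B] A.
rewrite map_inj_uniq ?enum_uniq; last by move=> i j [] /val_inj.
move=> /(_ isT (fun=> I)).
rewrite big_map (eq_bigr (fun=> 2^-1%:E)); last first.
  move=> i _; rewrite [LHS]digit_distribution fair_coinE /A /=.
  rewrite insubT //= => iB; rewrite (_ : Sub _ _ = i); last exact: val_inj.
  case: (v i); [rewrite mem_set // memNset //|rewrite memNset // mem_set //];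
    by rewrite mul0r ?addr0 ?add0r mul1r.
rewrite prodEFin big_enum /= prodr_const card_ord exprVn => <-.
congr (P _); apply/seteqP; split => w h /=.
  move=> _ /= /mapP[i _ ->]; rewrite /A /= insubT //= => iB; rewrite h.
  by congr (v _); exact: val_inj.
move=> i; have := h (t, val i); rewrite /A /= insubT //= => iB.
rewrite (_ : Sub _ _ = i); last exact: val_inj.
by apply; rewrite map_f // mem_enum.
Qed.

Lemma measurable_seed_vector (t B : nat) (v : {ffun 'I_B -> bool}) :
  measurable [set w : R | forall i : 'I_B, digit_seed t i w = v i].
Proof.
have -> : [set w : R | forall i : 'I_B, digit_seed t i w = v i] =
    \bigcap_(i in [set: 'I_B]) (digit_seed t i @^-1` [set v i]).
  by apply/seteqP; split => w h i => [_|]; [exact: h|exact: (h i I)].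
apply: fin_bigcap_measurable => [|i _]; first exact: finite_finset.
rewrite -[X in measurable X]setTI.
by apply: (measurable_digit (pickle (t, val i))).
Qed.

End Digits.

(** * Exact cancellation in a batch of signs *)

(** Flipping the first sign changes the sum by 2 in absolute value, so it maps balanced vectors
    injectively to unbalanced ones. *)
Lemma balanced_signs_card (R : realType) (n : nat) :
  (#|[set v : {ffun 'I_n.+1 -> bool} |
      (\sum_i (-1) ^+ v i == 0 :> R)%R]%SET|.*2 <= 2 ^ n.+1)%N.
Proof.
set bal := [set _ | _]%SET.
pose flip (v : {ffun 'I_n.+1 -> bool}) :=
  [ffun i => if i == ord0 then ~~ v i else v i].
have flipK : involutive flip.
  by move=> v; apply/ffunP => i; rewrite !ffunE; case: eqP => // _; rewrite negbK.
have disj : (bal :&: flip @: bal = finset.set0)%SET.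
  apply/finset.setP => v; rewrite !inE; apply/negbTE/negP.
  move=> /andP[/eqP v0 /imsetP[u]]; rewrite inE => /eqP u0 vu; move: v0 u0.
  rewrite vu !big_ord_recl !ffunE eqxx.
  rewrite (eq_bigr (fun i => (-1) ^+ u (lift ord0 i))); last first.
    by move=> i _; rewrite ffunE.
  move=> h1 h2; have /addIr := etrans h1 (esym h2).
  by case: (u ord0) => /=; rewrite ?expr0 ?expr1; lra.
have -> : (2 ^ n.+1)%N = #|{ffun 'I_n.+1 -> bool}| by rewrite card_ffun card_bool card_ord.
rewrite -addnn -[X in (_ + X)%N](card_imset _ (inv_inj flipK)).
by rewrite -cardsUI disj cards0 addn0 max_card.
Qed.

Section Batch.
Variables (R : realType) (t n : nat).
Local Notation balanced :=
  [set w : R | \sum_(i < n.+1) (-1) ^+ digit_seed R t i w = 0 :> R].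
Let bal := [set v : {ffun 'I_n.+1 -> bool} | \sum_i (-1) ^+ v i == 0 :> R]%SET.
Let C (v : {ffun 'I_n.+1 -> bool}) : set R :=
  [set w | forall i : 'I_n.+1, digit_seed R t i w = v i].

Let balancedE : balanced = \bigcup_(v in [set` bal]) C v.
Proof.
apply/seteqP; split => w /=.
  move=> h; exists [ffun i : 'I_n.+1 => digit_seed R t i w]; last first.
    by move=> i; rewrite ffunE.
  rewrite /= inE; apply/eqP; rewrite -[RHS]h.
  by apply: eq_bigr => i _; rewrite ffunE.
case=> v; rewrite /= inE => /eqP v0 h; rewrite -[RHS]v0.
by apply: eq_bigr => i _; congr (_ ^+ (nat_of_bool _)); exact: h.
Qed.

Lemma measurable_balanced_batch : measurable balanced.
Proof.
rewrite balancedE; apply: fin_bigcup_measurable => [|v _]; first exact: finite_finset.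
exact: measurable_seed_vector.
Qed.

Lemma balanced_batch_le_half : (uniform01 R balanced <= (2^-1)%:E)%E.
Proof.
rewrite balancedE.
rewrite measure_fin_bigcup //; last 2 first.
- by move=> u v _ _ [w [hu hv]]; apply/ffunP => i; rewrite -hu -hv.
- by move=> v _; exact: measurable_seed_vector.
rewrite (eq_fsbigr (fun=> (2 ^- n.+1)%:E)) => [|v _]; last exact: uniform01_seed_vector.
rewrite (fsbig_fwiden (enum bal)) ?enum_uniq //; last 2 first.
- by move=> v /= vb; rewrite mem_enum.
- by move=> v [] /=; rewrite mem_enum.
rewrite big_enum /= sumEFin lee_fin sumr_const -[_ *+ _]mulr_natr mulrC.
rewrite ler_pdivrMr ?exprn_gt0 // ler_pdivlMl // -natrX -natrM ler_nat mul2n.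
exact: balanced_signs_card.
Qed.

End Batch.

(** * The instance and its trajectories *)

Section Instance.
Variable R : realType.
Implicit Types (l eta : R) (x y : 'rV[R]_1) (w : R).

Definition coord x : R := x ord0 ord0.

Definition half_line : set 'rV[R]_1 := [set x | 0 <= coord x].

Definition tail_problem : problem R 1 :=
  Problem half_line coord (fun x => expR (- coord x)) expR 0
    (fun l => const_mx l).

(* On its support the square exp(-3l/2) is at most exp(-u) = |p'(u)|, which is
   what the relaxed variance bound asks for. *)
Definition noise_amplitude l (u : R) : R :=
  if l / 2 <= u <= 3 * l / 2 then expR (- (3 * l / 4)) else 0.

Definition coin_oracle : oracle R 1 :=
  @Oracle R 1 _ _ (fair_coin R) (fun _ _ => const_mx 1)
    (fun l x b => const_mx
       (- expR (- coord x) + noise_amplitude l (coord x) * (-1) ^+ (b : bool)))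
    _ _ (uniform01 R) (@digit_seed R).

Lemma rV1_eq x y : coord x = coord y -> x = y.
Proof. by move=> h; apply/rowP => i; rewrite ord1. Qed.

Lemma coord_const (c : R) : coord (const_mx c) = c.
Proof. by rewrite /coord mxE. Qed.

Lemma enorm_rV1 x : enorm x = `|coord x|.
Proof. by rewrite /enorm big_ord1 sqrtr_sqr. Qed.

(** [euclid_proj] is a chosen minimizer; comparing its distance with that of the clipped point
    forces the two to coincide. *)
Lemma coord_proj_half_line y :
  coord (euclid_proj half_line y) = Num.max 0 (coord y).
Proof.
have dist x : enorm (x - y) = `|coord x - coord y|.
  by rewrite enorm_rV1 /coord !mxE.
pose p : 'rV[R]_1 := const_mx (Num.max 0 (coord y)).
have p0 : half_line p by rewrite /half_line /= coord_const le_max lexx.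
have pmin : is_minimizer half_line (fun x => enorm (x - y)) p.
  split=> // x x0; rewrite !dist coord_const.
  have x0' : 0 <= coord x by [].
  case: (leP 0 (coord y)) => h; first by rewrite subrr normr0.
  by rewrite sub0r !ger0_norm; lra.
have [] := getI pmin; rewrite -/(euclid_proj half_line y).
set z := euclid_proj _ _ => z0 /(_ p p0).
have z0' : 0 <= coord z by [].
rewrite !dist coord_const; case: (leP 0 (coord y)) => h.
  by rewrite subrr normr0 normr_le0 subr_eq0 => /eqP.
by rewrite sub0r !ger0_norm; lra.
Qed.

Definition mean_sign (B t : nat) w : R :=
  B%:R^-1 * \sum_(i < B) (-1) ^+ digit_seed R t i w.

(** Reduces the vector iteration to a scalar recursion in which the coins enter only through the
    mean sign of the batch. *)
Lemma coord_iterateS l (a : scheme R) x0 t w :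
  let u := coord (iterate tail_problem coin_oracle l a x0 t w) in
  coord (iterate tail_problem coin_oracle l a x0 t.+1 w) =
  Num.max 0 (u - step a * (1 - expR (l - u)
    + expR l * noise_amplitude l u * mean_sign (batch a) t w)).
Proof.
move=> u; rewrite /= coord_proj_half_line; congr (Num.max _ _).
rewrite -/u /minibatch /= /coord !mxE summxE; congr (u - _ * _).
have B0 : (batch a)%:R != 0 :> R by rewrite pnatr_eq0 -lt0n batch_gt0.
rewrite (eq_bigr (fun i : 'I_(batch a) => (1 - expR (l - u)) +
    expR l * noise_amplitude l u * (-1) ^+ digit_seed R t i w)); last first.
  move=> i _; rewrite !mxE -/u expRD -[digit _ w]/(digit_seed R t i w).
  by move: ((-1) ^+ _) => s; ring.
rewrite big_split /= sumr_const card_ord -mulr_sumr /mean_sign.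
by rewrite mulrDr -(mulr_natl (1 - _)) mulKf // mulrCA.
Qed.

(** A sum of signs is an integer, so if nonzero it has absolute value at least 1. *)
Lemma mean_sign_norm (B t : nat) w :
  \sum_(i < B) (-1) ^+ digit_seed R t i w != 0 :> R ->
  B%:R^-1 <= `|mean_sign B t w|.
Proof.
rewrite /mean_sign normrM ger0_norm ?invr_ge0 //.
have -> : \sum_(i < B) (-1) ^+ digit_seed R t i w =
    (\sum_(i < B) (-1) ^+ digit_seed R t i w : int)%:~R :> R.
  by rewrite rmorph_sum; apply: eq_bigr => i _; rewrite rmorphXn /= rmorphN1.
move: (\sum_(i < B) _ : int) => k; rewrite intr_eq0 => k0.
rewrite ler_peMr ?invr_ge0 // -intr_norm ler1z; lia.
Qed.

(** An iterate depends on finitely many coins: splitting by the pattern [v] of the last batch gives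
    a finite union. The induction needs a general [Q], as it is applied to a preimage under
    [next]. *)
Lemma measurable_iterate l (a : scheme R) x0 t (Q : set 'rV[R]_1) :
  measurable [set w : R | Q (iterate tail_problem coin_oracle l a x0 t w)].
Proof.
elim: t Q => [|t IH] Q.
  have [q|q] := pselect (Q x0).
    rewrite [X in measurable X](_ : _ = setT) ?measurableT //.
    by apply/seteqP; split.
  by rewrite [X in measurable X](_ : _ = set0) //; apply/seteqP; split.
pose next x (v : {ffun 'I_(batch a) -> bool}) := euclid_proj half_line
  (x - step a *: ((batch a)%:R^-1 *: \sum_i (est_avg coin_oracle x (v i)
    + weight tail_problem l *: est_risk coin_oracle l x (v i)))).
have -> : [set w | Q (iterate tail_problem coin_oracle l a x0 t.+1 w)] =
    \bigcup_(v : {ffun 'I_(batch a) -> bool})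
      ([set w : R | forall i : 'I_(batch a), digit_seed R t i w = v i]
      `&` [set w | Q (next (iterate tail_problem coin_oracle l a x0 t w) v)]).
  have nextE (v : {ffun 'I_(batch a) -> bool}) w :
      (forall i : 'I_(batch a), digit_seed R t i w = v i) ->
      iterate tail_problem coin_oracle l a x0 t.+1 w =
      next (iterate tail_problem coin_oracle l a x0 t w) v.
    move=> wv; rewrite /next /= /minibatch; congr (euclid_proj _ (_ - _ *: (_ *: _))).
    by apply: eq_bigr => i _; rewrite -wv.
  apply/seteqP; split => w.
    move=> Qw; pose v := [ffun i : 'I_(batch a) => digit_seed R t i w].
    have wv : forall i : 'I_(batch a), digit_seed R t i w = v i.
      by move=> i; rewrite ffunE.
    exists v; first exact: I.
    by split; [exact: wv|move: Qw; rewrite /mkset (nextE _ _ wv)].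
  by case=> v _ [wv]; rewrite /mkset (nextE _ _ wv).
apply: fin_bigcup_measurable => [|v _]; first exact: finite_finset.
apply: measurableI; first exact: measurable_seed_vector.
exact: (IH [set x | Q (next x v)]).
Qed.

End Instance.

(** * Trajectories over at most exp(l/16) iterations *)

Section Escape.
Variables (R : realType) (l : R) (a : scheme R) (x0 : 'rV[R]_1).
Hypothesis l400 : 400 <= l.
Local Notation K := (expR (l / 16)).
Local Notation u t w :=
  (coord (iterate (tail_problem R) (coin_oracle R) l a x0 t w)).

Let K2 : 2 <= K.
Proof. by move: l400 => h; have := expR_ge1Dx (l / 16); lra. Qed.

(** The threshold 400 serves here: (1 + l/16)^2 >= 3l/2 because l^2/256 >= 11l/8 once l >= 352. *)
Let Ksq : 3 * l / 2 <= K ^+ 2.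
Proof.
move: l400 => h4; have h := expR_ge1Dx (l / 16); apply: le_trans (_ : (1 + l / 16) ^+ 2 <= _).
  by rewrite expr2; nra.
by rewrite ler_sqr ?nnegrE ?expR_ge0 //; lra.
Qed.

Let expK (n : nat) : expR (n%:R * (l / 16)) = K ^+ n.
Proof. by rewrite expRM_natl. Qed.

(** Right of 3l/2 the noise is off and the gradient 1 - exp(l-u) is at most 1, so each iteration
    uses up at most one step of the reserve [step a * K]. *)
Lemma escape (w : R) (s d : nat) :
  3 * l / 2 + step a * K <= u s w -> d%:R <= K ->
  3 * l / 2 + step a * (K - d%:R) <= u (s + d) w.
Proof.
move: l400 K2 Ksq => h4 k2 ksq.
move=> us; elim: d => [_|d IH]; first by rewrite subr0 addn0.
rewrite -natr1 => dK; have {}IH := IH (le_trans _ dK).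
have {IH} : 3 * l / 2 + step a * (K - d%:R) <= u (s + d) w by apply: IH; lra.
have := step_gt0 a; rewrite addnS coord_iterateS; set v := u _ w; set e := step a.
move=> e0 vd; have := expR_ge0 (l - v).
(* At least one unit of [K - d] is left, so the inequality is strict and [v] is outside the closed
   noise band. *)
have lv : 3 * l / 2 < v by nra.
rewrite /noise_amplitude [v <= _]leNgt lv andbF mulr0 mul0r addr0 le_max => E.
by apply/orP; right; nra.
Qed.

(** The target is 5(l+1)/4. In the first case the loss alone is at least 3l/2; in the second the
    weighted risk is exp(l). *)
Lemma target_missed (x : 'rV[R]_1) :
  3 * l / 2 <= coord x \/ coord x = 0 ->
  ~ (objective (tail_problem R) l x <=
     (1 + 4^-1) * objective (tail_problem R) l (xstar (tail_problem R) l)).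
Proof.
move: l400 K2 Ksq => h4 k2 ksq.
rewrite /objective /= coord_const -!expRD subrr expR0.
case=> [h|->]; last rewrite subr0 add0r.
  by have := expR_ge0 (l - coord x); lra.
(* Writing exp(l) as a square gives a quadratic lower bound; the linear bound 1 + l would fall short
   of 5(l+1)/4. *)
rewrite -[l in expR l](_ : 2%:R * (l / 2) = l); last by field.
by rewrite expRM_natl; have := expR_ge1Dx (l / 2); nra.
Qed.

(** The noise shifts the iterate by at least [step a * K ^+ 3], more than [K ^+ 2] and hence than
    3l/2, while the drift is at most one step. The sign of the batch mean decides between projection
    to 0 and a throw to the right. *)
Lemma first_step (w : R) :
  coord x0 = 3 * l / 2 -> K^-1 < step a -> (batch a)%:R < K ->
  \sum_(i < batch a) (-1) ^+ digit_seed R 0 i w != 0 :> R ->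
  u 1 w = 0 \/ 3 * l / 2 + step a * K <= u 1 w.
Proof.
move: l400 K2 Ksq => h4 k2 ksq.
move=> x0E eK BK S0; have := mean_sign_norm S0; set S := mean_sign _ _ _ => SB.
(* The noise band is closed, so it contains the start 3l/2. *)
rewrite coord_iterateS -/S /= x0E /noise_amplitude ifT; last lra.
have -> : expR l * expR (- (3 * l / 4)) = K ^+ 4.
  by rewrite -expRD -expK; congr expR; field.
have B0 : 0 < (batch a)%:R :> R by rewrite ltr0n batch_gt0.
have K0 : 0 < K by exact: expR_gt0.
have KS : K ^+ 3 <= K ^+ 4 * `|S|.
  apply: le_trans (ler_wpM2l _ SB); last by rewrite exprn_ge0 // ltW.
  by rewrite ler_pdivlMr // [leRHS]exprSr ler_wpM2l ?exprn_ge0 ?ltW.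
have e0 := step_gt0 a; set e := step a in eK e0 *.
have eK1 : 1 < e * K by rewrite -ltr_pdivrMr // div1r.
have E : 0 <= expR (l - 3 * l / 2) <= 1.
  by rewrite expR_ge0 -[leRHS]expR0 ler_expR; lra.
case: (lerP 0 S) => hS; [left|right].
  rewrite ger0_norm // in KS; apply/max_idPl.
  have : K ^+ 2 <= e * K ^+ 3.
    have -> : e * K ^+ 3 = e * K * K ^+ 2 by ring.
  by rewrite -[leLHS]mul1r ler_wpM2r ?sqr_ge0 ?ltW.
  nra.
rewrite ltr0_norm // in KS; rewrite le_max; apply/orP; right.
have : K + 1 <= K ^+ 3 by rewrite exprS expr2; nra.
nra.
Qed.

Lemma second_step (t : nat) (w : R) :
  K^-1 < step a -> u t w = 0 -> 3 * l / 2 + step a * K <= u t.+1 w.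
Proof.
move: l400 K2 Ksq => h4 k2 ksq.
move=> eK ut; rewrite coord_iterateS ut subr0 /noise_amplitude ifF; last lra.
rewrite mulr0 mul0r addr0 sub0r le_max; apply/orP; right.
have -> : expR l = K ^+ 16 by rewrite -expK; congr expR; field.
have K0 : 0 < K by exact: expR_gt0.
have e0 := step_gt0 a; set e := step a in eK e0 *.
have eK1 : 1 < e * K by rewrite -ltr_pdivrMr // div1r.
have K1 : 1 <= K by lra.
(* Of the push [K ^+ 16 - 1], a part [K ^+ 4] is enough: it pays for the 1, for the reserve [K] and,
   through [K ^+ 3], for the distance 3l/2. *)
have : K ^+ 4 <= K ^+ 16 by rewrite ler_weXn2l.
have : K + 1 + K ^+ 3 <= K ^+ 4 by rewrite !exprS expr0 mulr1; nra.
have : K ^+ 2 <= e * K ^+ 3.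
  have -> : e * K ^+ 3 = e * K * K ^+ 2 by ring.
  by rewrite -[leLHS]mul1r ler_wpM2r ?sqr_ge0 ?ltW.
nra.
Qed.

End Escape.

(** * Exponential lower bound on the sampling complexity *)

Section LogRate.
Variables (R : realType) (h : R -> \bar R) (c M : R).

Lemma limsup_log_rate_le :
  (forall l, M < l -> (lne (h l) <= (c * l)%:E)%E) ->
  (limsup_log_rate h <= c%:E)%E.
Proof.
move=> H; apply: ge_ereal_inf; exists (ereal_sup (log_rate h @` [set l | Num.max 0 M < l])).
  by exists [set l | Num.max 0 M < l] => //; exists (Num.max 0 M); split => //; exact: num_real.
apply: ge_ereal_sup => _ [l /= + <-]; rewrite gt_max => /andP[l0 Ml].
rewrite /log_rate muleC lee_pdivrMr //; exact: H.
Qed.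

Lemma limsup_log_rate_ge :
  (forall l, M < l -> ((c * l)%:E <= lne (h l))%E) ->
  (c%:E <= limsup_log_rate h)%E.
Proof.
move=> H; apply/ereal_infP => _ [V [N [_ NV]] <-].
(* A point of the given neighbourhood that is also positive and beyond [M]. *)
set l := Num.max (Num.max 0 M) N + 1.
have m1 : Num.max 0 M <= Num.max (Num.max 0 M) N by rewrite le_max lexx.
have m2 : N <= Num.max (Num.max 0 M) N by rewrite le_max lexx orbT.
have m3 : 0 <= Num.max 0 M by rewrite le_max lexx.
have m4 : M <= Num.max 0 M by rewrite le_max lexx orbT.
apply: le_ereal_sup_tmp; exists (log_rate h l).
  by exists l => //; apply: NV; rewrite /l; lra.
rewrite /log_rate muleC lee_pdivlMr; last by rewrite /l; lra.
by apply: H; rewrite /l; lra.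
Qed.

End LogRate.

Lemma lne_expR (R : realType) (u : R) : lne (expR u)%:E = u%:E.
Proof. by rewrite lne_EFin ?expR_gt0 // expRK. Qed.

Lemma limsup_log_rate_linear (R : realType) (h : R -> R) :
  (forall l, 0 < l -> 0 < h l <= 2 * l) ->
  (limsup_log_rate (fun l => (h l)%:E) <= 0)%E.
Proof.
move=> H; apply/lee_addgt0Pr => e e0; rewrite add0e.
(* For l > 8/e^2 one has 2l <= (el/2)^2 <= (1 + el/2)^2 <= exp(el). *)
apply: (@limsup_log_rate_le _ _ _ (8 / e ^+ 2)) => l Ml.
have e20 : 0 < e ^+ 2 by rewrite exprn_gt0.
have l0 : 0 < l by apply: lt_trans Ml; rewrite divr_gt0.
have /andP[h0 hl] := H l l0.
rewrite lne_EFin // lee_fin -(expRK (e * l)) ler_ln ?posrE ?expR_gt0 //.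
apply: (le_trans hl).
rewrite (_ : e * l = 2%:R * (e * l / 2)); last by field.
rewrite expRM_natl; apply: (@le_trans _ _ ((1 + e * l / 2) ^+ 2)).
  rewrite ltr_pdivrMr // in Ml.
  have : 8 * l <= l * e ^+ 2 * l by rewrite ler_pM2r // ltW.
  have : 0 < e * l by rewrite mulr_gt0.
  by rewrite !expr2; nra.
rewrite ler_sqr ?nnegrE ?expR_ge0 ?expR_ge1Dx //.
by have : 0 < e * l by [rewrite mulr_gt0|]; lra.
Qed.

(** Small steps begin at distance l/2 beyond the noise band, larger ones on its right endpoint,
    where the noise acts. *)
Definition start (R : realType) (A : R -> scheme R) (l : R) : 'rV[R]_1 :=
  const_mx (if step (A l) <= (expR (l / 16))^-1 then 2 * l else 3 * l / 2).

Section Complexity.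
Variables (R : realType) (A : R -> scheme R) (l : R).
Hypothesis l400 : 400 <= l.
Local Notation K := (expR (l / 16)).
Local Notation x t w :=
  (iterate (tail_problem R) (coin_oracle R) l (A l) (start A l) t w).
Local Notation success t := [set w : R |
  objective (tail_problem R) l (x t w) <=
    (1 + 4^-1) * objective (tail_problem R) l (xstar (tail_problem R) l)].

(** The sample bound serves twice: fewer than [K] iterations are too few to come back, and a batch
    smaller than [K] cannot average the noise away. *)
Lemma unbalanced_batch_fails (T : nat) (w : R) :
  (T * batch (A l))%:R < K ->
  \sum_(i < batch (A l)) (-1) ^+ digit_seed R 0 i w != 0 :> R ->
  ~ success T w.
Proof.
move: (l400) => l4 TBK S0; apply: (target_missed l400).
have K0 : 0 < K by exact: expR_gt0.
have e0 := step_gt0 (A l).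
have startE : coord (start A l) =
  if step (A l) <= K^-1 then 2 * l else 3 * l / 2 by rewrite /start coord_const.
(* Without iterations the product says nothing about the batch, but the start itself misses the
   target. *)
case: T TBK => [_|T TBK].
  by left; rewrite [x _ _]/= startE; case: ifP; lra.
have TK : T.+1%:R <= K.
  by apply/ltW/(le_lt_trans _ TBK); rewrite ler_nat leq_pmulr ?batch_gt0.
have BK : (batch (A l))%:R < K.
  by apply: le_lt_trans TBK; rewrite ler_nat leq_pmull.
have far s d : 3 * l / 2 + step (A l) * K <= coord (x s w) -> d%:R <= K ->
    3 * l / 2 <= coord (x (s + d) w).
  move=> h dK; have := escape l400 h dK.
  have : 0 <= step (A l) * (K - d%:R) by rewrite mulr_ge0 ?subr_ge0 // ltW.
  lra.
have [hs|hs] := leP (step (A l)) K^-1.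
  left; rewrite -[T.+1]add0n; apply: far => //; rewrite [x _ _]/= startE hs.
  (* The head start l/2 exceeds 1, hence covers [step (A l) * K]. *)
  have : step (A l) * K <= 1 by rewrite -ler_pdivlMr // div1r.
  lra.
have start0 : coord (start A l) = 3 * l / 2 by rewrite startE leNgt hs.
have [u1|u1] := first_step l400 start0 hs BK S0.
  (* A run of one iteration stops at 0, where the target is missed as well. *)
  case: T TBK TK => [|T] _ TK; first by right.
  left; rewrite -[T.+2]add2n; apply: (far 2%N T); first exact: second_step.
  by apply: le_trans TK; rewrite ler_nat; lia.
left; rewrite -[T.+1]add1n; apply: far => //.
by apply: le_trans TK; rewrite ler_nat.
Qed.

(** Success forces the signs of the first batch to cancel exactly. *)
Lemma success_prob_le_half (T : nat) :
  (T * batch (A l))%:R < K -> (uniform01 R (success T) <= (2^-1)%:E)%E.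
Proof.
move=> TBK; have := @unbalanced_batch_fails T ^~ TBK.
case: (batch (A l)) (batch_gt0 (A l)) => // n _ H.
apply: (le_trans _ (balanced_batch_le_half R 0 n)); apply: le_measure.
- rewrite inE; exact: (measurable_iterate _ _ _ _ [set z | objective (tail_problem R) l z <=
    (1 + 4^-1) * objective (tail_problem R) l (xstar (tail_problem R) l)]).
- by rewrite inE; exact: measurable_balanced_batch.
- by move=> w sw /=; apply/eqP; apply: contrapT => /negP /(H w).
Qed.

Lemma sampling_complexity_ge :
  (K%:E <= sampling_complexity (tail_problem R) (coin_oracle R) 4^-1 4^-1 l
    (A l) (start A l))%E.
Proof.
apply/ereal_infP => _ [T /= PT <-]; rewrite lee_fin leNgt; apply/negP => TBK.
(* The required probability is 3/4, and at most 1/2 is available. *)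
have := le_trans PT (success_prob_le_half TBK); rewrite lee_fin; lra.
Qed.

End Complexity.

Lemma limsup_sampling_complexity_gt0 (R : realType) (A : R -> scheme R) :
  (0 < limsup_log_rate (fun l => sampling_complexity (tail_problem R)
    (coin_oracle R) 4^-1 4^-1 l (A l) (start A l)))%E.
Proof.
apply: (@lt_le_trans _ _ (16^-1)%:E); first by rewrite lte_fin; lra.
apply: (@limsup_log_rate_ge _ _ _ 400) => l /ltW l400.
rewrite -lne_expR mulrC; have := sampling_complexity_ge A l400.
set s := sampling_complexity _ _ _ _ _ _ _ => Ks.
have K0 : (0 <= (expR (l / 16))%:E)%E by rewrite lee_fin expR_ge0.
rewrite lee_lne // in_itv /= ?leey ?andbT //; exact: le_trans Ks.
Qed.

Lemma start_bounds (R : realType) (A : R -> scheme R) (l : R) : 0 < l ->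
  3 * l / 2 <= coord (start A l) <= 2 * l.
Proof. by move=> l0; rewrite coord_const; case: ifP => _; lra. Qed.

(** * The instance satisfies the assumptions *)

Section FairCoin.
Variable R : realType.
Implicit Types f : bool -> R.

Lemma fair_coin_integral f : (forall b, 0 <= f b) ->
  (\int[fair_coin R]_b (f b)%:E = ((f true + f false) / 2)%:E)%E.
Proof.
move=> f0; rewrite /fair_coin /= integral_bernoulli_prob; last 2 first.
- by lra.
- by move=> b; rewrite lee_fin.
rewrite -!EFinM -EFinD /unstable.onem; congr EFin; lra.
Qed.

Lemma fair_coin_measurable f : measurable_fun setT f.
Proof. by move=> _ Y mY; exact: I. Qed.

Lemma fair_coin_integrable f : (fair_coin R).-integrable setT (EFin \o f).
Proof.
apply/integrableP; split; first by move=> _ Y mY; exact: I.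
rewrite (eq_integral (fun b => `|f b|%:E)) // fair_coin_integral ?ltry //.
Qed.

Lemma fair_coin_expectation f :
  ('E_(fair_coin R)[f] = ((f true + f false) / 2)%:E)%E.
Proof.
(* Adding [c] makes [f] nonnegative, so that [fair_coin_integral] applies; it is subtracted at the
   end. *)
have [c fc] : exists c, forall b, 0 <= f b + c.
  exists (`|f true| + `|f false|); case;
  have := normr_ge0 (f true); have := normr_ge0 (f false);
  have := ler_norm (- f true); have := ler_norm (- f false); rewrite !normrN; lra.
have : ('E_(fair_coin R)[f] + c%:E = ((f true + f false) / 2)%:E + c%:E)%E.
  rewrite unlock -[c%:E in LHS](_ : (\int[fair_coin R]_b c%:E)%E = _); last first.
    rewrite integral_cst //=.
    by rewrite [X in (_ * X)%E](@probability_setT _ _ _ (fair_coin R)) mule1.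
  rewrite -integralD //; [|exact: fair_coin_integrable|
    exact: (fair_coin_integrable (fun=> c))].
  rewrite -[LHS]/(\int[fair_coin R]_b (f b + c)%:E)%E fair_coin_integral //.
  by rewrite -EFinD; congr EFin; lra.
by move/(congr1 (fun z => z - c%:E)%E); rewrite !addeK.
Qed.

End FairCoin.

(** * Functions of one coordinate: derivatives, convexity, measurability *)

Section Coordinate.
Variable R : realType.
Implicit Types (x : 'rV[R]_1) (h : R -> R).

Lemma is_diff_coord x : is_diff x (@coord R) (@coord R).
Proof.
have lin : linear (@coord R) by move=> k y z; rewrite /coord !mxE.
pose f : {linear 'rV[R]_1 -> R} := HB.pack (@coord R)
  (GRing.isLinear.Build _ _ _ _ _ lin).
apply: DiffDef; first exact: differentiable_coord.
by rewrite (@diff_lin _ _ _ f) //; exact: coord_continuous.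
Qed.

Lemma is_diff_ridge h (h' : R) x : is_derive (coord x) 1 h h' ->
  is_diff x (h \o @coord R) (fun v => coord v * h').
Proof.
move=> hh'; have dh : differentiable h (coord x) by apply/derivable1_diffP; exact: ex_derive.
have dc := is_diff_coord x.
apply: DiffDef; first exact: differentiable_comp.
rewrite diff_comp // diff1E // diff_val; apply/funext => v /=.
by rewrite derive1E derive_val.
Qed.

Lemma gradient_ridge h (h' : R) x : is_derive (coord x) 1 h h' ->
  gradient (h \o @coord R) x = const_mx h'.
Proof.
move=> /is_diff_ridge dh; apply/rowP => i; rewrite !mxE deriveE // diff_val.
by rewrite (ord1 i) /coord mxE !eqxx mul1r.
Qed.

Section Ridge.
Variables (h h1 h2 h3 : R -> R).
Hypothesis hh1 : forall u : R, is_derive u 1 h (h1 u).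
Hypothesis h1h2 : forall u : R, is_derive u 1 h1 (h2 u).
Hypothesis h2h3 : forall u : R, is_derive u 1 h2 (h3 u).

Let gradientE : gradient (h \o @coord R) =
  (fun x => (h1 \o @coord R) x *: const_mx 1).
Proof.
apply/funext => x; rewrite (gradient_ridge (hh1 (coord x))).
by apply/rowP => i; rewrite !mxE mulr1.
Qed.

Lemma hessian_ridge x : hessian (h \o @coord R) x = const_mx (h2 (coord x)).
Proof.
have d1 := is_diff_ridge (h1h2 (coord x)).
apply/matrixP => i j; rewrite /hessian /jacobian gradientE !mxE diffZl //.
by rewrite diff_val (ord1 i) (ord1 j) /coord !mxE mulr1 !eqxx mul1r.
Qed.

(** The third derivative [h3] makes the Hessian differentiable, hence continuous. *)
Lemma C2_on_ridge (X : set 'rV[R]_1) : C2_on X (h \o @coord R).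
Proof.
exists setT; split; [exact: openT|by []|].
move=> x _; have d1 := is_diff_ridge (h1h2 (coord x)).
have d := is_diff_ridge (hh1 (coord x)).
split; [exact: ex_diff|by rewrite gradientE; exact: differentiableZl|].
rewrite (_ : hessian _ = fun x => h2 (coord x) *: const_mx 1); last first.
  apply/funext => y; rewrite hessian_ridge.
  by apply/matrixP => i j; rewrite !mxE mulr1.
apply: differentiable_continuous; apply: differentiableZl.
by have d2 := is_diff_ridge (h2h3 (coord x)); exact: ex_diff.
Qed.

End Ridge.

Lemma spectral_norm_const_mx1 (c : R) :
  spectral_norm (const_mx c : 'M[R]_1) <= `|c|.
Proof.
apply: ge_sup.
  exists (enorm ((0 : 'rV[R]_1) *m (const_mx c : 'M[R]_1))); exists 0 => //=.
  by rewrite enorm_rV1 /coord mxE normr0.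
move=> _ [v /= v1 <-]; move: v1; rewrite !enorm_rV1 /coord mxE big_ord1 mxE normrM => v1.
by rewrite ler_piMl.
Qed.

Lemma convex_half_line : convex_set (@half_line R).
Proof.
move=> x y t /set_mem x0 /set_mem y0; apply/mem_set.
move: x0 y0; rewrite /half_line /= /coord /conv /= !mxE => x0 y0.
by rewrite addr_ge0 // mulr_ge0 // ?subr_ge0 ?ge0 ?le1.
Qed.

Lemma convex_ridge (X : set 'rV[R]_1) h :
  (forall (t : {i01 R}) (u v : R),
    h (t%:num * u + (1 - t%:num) * v) <= t%:num * h u + (1 - t%:num) * h v) ->
  convex_function X (h \o @coord R).
Proof.
move=> hh t x y _ _; have := hh t (coord x) (coord y).
by rewrite /coord /conv /= !mxE.
Qed.

Lemma measurable_coord :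
  measurable_fun setT (@coord R : g_sigma_algebraType (@open 'rV[R]_1) -> R).
Proof.
move=> mD; apply: (measurability _ (RGenOInfty.measurableE R)) => //.
move=> _ [_ [r ->] <-]; rewrite setTI; apply: sub_gen_smallest.
apply: open_comp; last exact: rray_open.
by move=> x _; exact: coord_continuous.
Qed.

End Coordinate.

(** * Checks of the individual assumptions *)

Section Assumptions.
Variable R : realType.
Local Notation pb := (tail_problem R).
Local Notation orc := (coin_oracle R).

Let is_derive_id (u : R) : is_derive u 1 (@id R) 1.
Proof. exact: is_derive_id. Qed.

Let is_derive_cst (c u : R) : is_derive u 1 (fun=> c) 0.
Proof. exact: is_derive_cst. Qed.

Let is_derive_expN (u : R) : is_derive u 1 (fun u => expR (- u)) (- expR (- u)).
Proof. by apply: is_derive_eq; rewrite mulrN1. Qed.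

Let is_derive_opp_expN (u : R) :
  is_derive u 1 (fun u => - expR (- u)) (expR (- u)).
Proof. by apply: is_derive_eq; rewrite mulrN1 opprK. Qed.

Let gradient_loss x : gradient (avg_loss pb) x = const_mx 1.
Proof. exact: (gradient_ridge (is_derive_id (coord x))). Qed.

Let gradient_risk x : gradient (risk pb) x = const_mx (- expR (- coord x)).
Proof. exact: (gradient_ridge (is_derive_expN (coord x))). Qed.

Let convex_expN (t : {i01 R}) (u v : R) :
  expR (- (t%:num * u + (1 - t%:num) * v)) <=
  t%:num * expR (- u) + (1 - t%:num) * expR (- v).
Proof.
have := convex_expR t (- u) (- v); rewrite !convRE.
by rewrite opprD -!mulrN.
Qed.

Lemma tail_well_posed : well_posed pb.
Proof.
split=> [x _|l l0||l l0]; first exact: expR_ge0.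
- exact: expR_gt0.
- by split; rewrite /= ?/half_line /= /coord ?mxE //; move=> y y0; rewrite mxE.
split; first by rewrite /= /half_line /= coord_const ltW.
move=> y _; rewrite /objective /= coord_const -!expRD subrr expR0.
(* Since exp(l-u) >= 1 + l - u, the objective at u is at least l + 1, its value at l. *)
by have := expR_ge1Dx (l - coord y); lra.
Qed.

Lemma coin_iid_seeds : iid_seeds orc.
Proof.
split; last exact: digit_seeds_independent.
by move=> t i B _; exact: digit_distribution.
Qed.

Lemma tail_ldp_target_risk : ldp_target_risk pb 1.
Proof.
split; first exact: ltr01.
- apply: cvg_near_cst; exists 0; split => [|l l0]; first exact: real0.
  rewrite /log_rate [risk _ _]/= coord_const lne_expR -EFinM mulrN mulVf //.
  by rewrite gt_eqF.
- apply/eqP; rewrite eq_le; apply/andP; split.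
    by apply: (@limsup_log_rate_le _ _ _ 0) => l _; rewrite lne_expR mul1r.
  by apply: (@limsup_log_rate_ge _ _ _ 0) => l _; rewrite lne_expR mul1r.
Qed.

Lemma noise_amplitude_sqr (l u : R) : 0 < l ->
  noise_amplitude l u ^+ 2 <= expR (- u).
Proof.
move=> l0; rewrite /noise_amplitude; case: ifP => h; last first.
  by rewrite expr0n expR_ge0.
by rewrite -expRM_natl ler_expR; lra.
Qed.

Lemma measurable_noise_amplitude (l : R) :
  measurable_fun setT (noise_amplitude l).
Proof.
apply: measurable_fun_if => //.
by apply: measurable_and; exact: measurable_fun_ler.
Qed.

Lemma coin_relaxed_variance : relaxed_variance_estimators pb orc.
Proof.
split=> [i|l l0 i|].
- rewrite (_ : (fun z => _) = fun=> 1); first exact: measurable_cst.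
  by apply/funext => z; rewrite mxE.
- apply: measurable_funTS.
  have mc : measurable_fun setT (fun z : g_sigma_algebraType (@open 'rV[R]_1) * bool =>
      coord z.1) by apply: (measurableT_comp (@measurable_coord R)).
  rewrite (_ : (fun z => _) = fun z : g_sigma_algebraType (@open 'rV[R]_1) * bool =>
    - expR (- coord z.1) + noise_amplitude l (coord z.1) * (-1) ^+ z.2); last first.
    by apply/funext => z; rewrite mxE.
  apply: measurable_funD.
    apply: measurableT_comp => //; apply: measurableT_comp => //.
    exact: measurableT_comp.
  apply: measurable_funM.
    exact: (measurableT_comp (measurable_noise_amplitude l) mc).
  exact: (measurableT_comp (fair_coin_measurable (fun b => (-1) ^+ b))).
(* The loss oracle is exact, so its variance bound is 0. The squared error of the risk estimator is
   [noise_amplitude] squared for either coin, at most |p'|, whence the constant 1. *)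
exists 0, 1; split=> // l l0 x x0; split.
- move=> i; split; first exact: fair_coin_integrable.
  by rewrite fair_coin_expectation /= gradient_loss !mxE; congr EFin; field.
- move=> i; split; first exact: fair_coin_integrable.
  rewrite fair_coin_expectation /= gradient_risk !mxE expr0 expr1.
  by congr EFin; field.
- rewrite /mean_square_error fair_coin_expectation gradient_loss /= subrr.
  by rewrite enorm_rV1 /coord mxE normr0 lee_fin; lra.
rewrite /mean_square_error fair_coin_expectation gradient_risk /= !enorm_rV1.
rewrite /coord !mxE expr0 expr1 !real_normK ?num_real // lee_fin mul1r normrN.
rewrite ger0_norm ?expR_ge0 //; have := noise_amplitude_sqr (coord x) l0.
by rewrite /coord; nra.
Qed.

Lemma tail_smooth_convex_loss : smooth_convex_loss pb.
Proof.
split; last first.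
  exists 1; split=> // x _; rewrite (hessian_ridge is_derive_id (is_derive_cst 1)).
  by apply: le_trans (spectral_norm_const_mx1 _) _; rewrite normr0.
split.
- by exists 0; rewrite /= /half_line /= /coord mxE.
- rewrite (_ : feas pb = @coord R @^-1` [set u | 0 <= u]) //.
  apply: closed_comp; last exact: closed_ge.
  by move=> x _; exact: coord_continuous.
- exact: convex_half_line.
- exact: (C2_on_ridge is_derive_id (is_derive_cst 1) (is_derive_cst 0)).
- exact: (@convex_ridge _ _ id).
Qed.

Lemma tail_sublevel_bounded : sublevel_bounded pb.
Proof.
exists 1, 1; split=> //.
  by exists 0; rewrite /= /half_line /= /coord mxE; split.
move=> x y x0 x1 y0 y1; rewrite enorm_rV1.
have -> : coord (x - y) = coord x - coord y by rewrite /coord !mxE.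
have {}x0 : 0 <= coord x by [].
have {}y0 : 0 <= coord y by [].
have {}x1 : coord x <= 1 by [].
have {}y1 : coord y <= 1 by [].
by rewrite ler_norml; lra.
Qed.

Lemma tail_zero_min_loss : zero_min_loss pb.
Proof. by rewrite /zero_min_loss /= /coord mxE. Qed.

Lemma tail_relative_bounds : relative_bounds pb.
Proof.
split.
  exact: (C2_on_ridge is_derive_expN is_derive_opp_expN is_derive_expN).
(* Here |p'| = p'' = p, and the factor depending on the distance is at least 1. *)
exists 1, 1, 0, 0; split=> // x _.
have e0 := expR_ge0 (- coord x).
rewrite gradient_risk enorm_rV1 coord_const normrN ger0_norm //.
rewrite (hessian_ridge is_derive_expN is_derive_opp_expN).
have := spectral_norm_const_mx1 (expR (- coord x)); rewrite ger0_norm //.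
have := powR_ge0 (enorm (x - 0)) (0 : R); set q := _ `^ _.
by rewrite /= -/q => q0 hs; split; nra.
Qed.

Lemma tail_convex_objective : convex_objective pb.
Proof.
move=> l l0; apply: (@convex_ridge _ _ (fun u => u + expR l * expR (- u))) => t u v.
have := convex_expN t u v; have := expR_gt0 l; nra.
Qed.

End Assumptions.

Theorem theorem3 (R : realType) :
  exists eps kappa : R, [/\ 0 < eps, 0 < kappa & kappa < 1] /\
  exists (n : nat) (pb : problem R n) (orc : oracle R n) (I : R),
    [/\ well_posed pb,
        iid_seeds orc,
        ldp_target_risk pb I,
        relaxed_variance_estimators pb orc &
        smooth_convex_loss pb] /\
    [/\ sublevel_bounded pb,
        zero_min_loss pb,
        relative_bounds pb &
        convex_objective pb] /\
    forall A : R -> scheme R,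
      exists x0 : R -> 'rV[R]_n,
        [/\ forall l : R, 0 < l -> feas pb (x0 l),
            safe_start pb I x0,
            subexp_initial_distance pb x0 &
            (0 < limsup_log_rate (fun l : R =>
                   sampling_complexity pb orc eps kappa l (A l) (x0 l)))%E].
Proof.
(* The first 1/4 keeps the target 5(l+1)/4 below 3l/2 for large l; the second asks for probability
   3/4, more than 1/2. *)
exists 4^-1, 4^-1; split; first by split; lra.
exists 1%N, (tail_problem R), (coin_oracle R), 1; split.
  split; [exact: tail_well_posed|exact: coin_iid_seeds|
    exact: tail_ldp_target_risk|exact: coin_relaxed_variance|
    exact: tail_smooth_convex_loss].
split.
  split; [exact: tail_sublevel_bounded|exact: tail_zero_min_loss|
    exact: tail_relative_bounds|exact: tail_convex_objective].
move=> A; exists (start A); have startb l : 0 < l -> _ := @start_bounds R A l.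
split; last exact: limsup_sampling_complexity_gt0.
- by move=> l l0; have := startb l l0; rewrite /= /half_line /=; lra.
(* The start is at least 3l/2, so its risk is below exp(-l). *)
- apply: (@limsup_log_rate_le _ _ _ 0) => l l0.
  by rewrite [risk _ _]/= lne_expR lee_fin; have := startb l l0; lra.
- apply: limsup_log_rate_linear => l l0.
  rewrite [xtilde _]/= subr0 enorm_rV1 ger0_norm; have := startb l l0; lra.
Qed.
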